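(* Let $\mathbf{C}$ be a finite monoidal category and let $X\in\mathbf{C}$ be an object. Let $M(X)$ be the action matrix of $X$ (for left tensoring with $X$), and assume that it satisfies the following Perron--Frobenius condition: $M(X)$ has a leading eigenvalue $\lambda_0=\mathrm{PFdim}\,X\in\mathbb{R}_{>0}$ (that is, $\lambda_0\geq|\mu|$ for all eigenvalues $\mu$ of $M(X)$) of multiplicity one, and there is an integer $h\geq 1$ (the period) such that, with $\zeta=\exp(2\pi i/h)$, the numbers $\lambda_k=\zeta^k\,\mathrm{PFdim}\,X$ for $k\in\{1,\dots,h-1\}$ are precisely the other eigenvalues of $M(X)$ of absolute value $\mathrm{PFdim}\,X$. For $k\in\{0,\dots,h-1\}$ let $v_k$ and $w_k$ be right and left eigenvectors, $M(X)v_k=\lambda_kv_k$ and $w_k^TM(X)=\lambda_kw_k^T$, normalized such that $w_k^Tv_k=1$, and let $v_kw_k^T[1]$ denote the sum of the entries of the first column (the column indexed by the monoidal unit) of the matrix $v_kw_k^T$. Put $$a(n)=\Big(\sum_{k=0}^{h-1}v_kw_k^T[1]\cdot(\zeta^k)^n\Big)\cdot(\mathrm{PFdim}\,X)^n .$$ Then $$b^{\mathbf{C},X}(n)\sim a(n),$$ and the convergence is geometric with ratio $|\lambda^{sec}/\mathrm{PFdim}\,X|$, where $\lambda^{sec}$ is any second largest eigenvalue of $M(X)$. In particular, $$\lim_{n\to\infty}\sqrt[n]{b^{\mathbf{C},X}(n)}=\mathrm{PFdim}\,X .$$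
   Context: A finite monoidal category is a category $\mathbf{C}$ that is monoidal, additive Krull--Schmidt, and has finitely many isomorphism classes of indecomposable objects. The tensor product is additive in each variable and the monoidal unit $\mathbf{1}$ is indecomposable, so that the additive Grothendieck ring has as basis the classes of indecomposable objects, including the class of $\mathbf{1}$. Let $X_0=\mathbf{1},X_1,\dots,X_{r-1}$ be representatives of the isomorphism classes of indecomposable objects. $b^{\mathbf{C},X}(n)=b_n^{\mathbf{C},X}$ is the number of indecomposable summands in $X^{\otimes n}$, counted with multiplicities. The pre action matrix of $X$ is the $r\times r$ matrix $M'(X)$ whose entry $M'(X)_{k,j}$ is the multiplicity of $X_k$ as a direct summand of $X\otimes X_j$. Its adjacency graph is the weighted oriented graph on the index set with an edge of weight $M'(X)_{k,j}$ from $k$ to $j$ (whenever nonzero). The action matrix $M(X)$ is the submatrix of $M'(X)$ whose rows and columns are indexed by the connected component, in the nonoriented sense, of the vertex corresponding to $\mathbf{1}$; $\mathbf{1}$ is kept as the first index. ''Second largest eigenvalue'' $\lambda^{sec}$: an eigenvalue of $M(X)$ of largest absolute value among those of absolute value strictly smaller than $\mathrm{PFdim}\,X$ (take $\lambda^{sec}=0$ if there is none). $f(n)\sim g(n)$ means $f(n)/g(n)\to1$ as $n\to\infty$. A sequence $f(n)$ converges geometrically to $a$ with ratio $\beta\in[0,1)$ if for all $\gamma\in(\beta,1)$ the sequence $(f(n)-a)/\gamma^n$ is bounded; here this is applied to $b^{\mathbf{C},X}(n)/a(n)\to 1$ (for $n$ large enough that $a(n)\neq0$). *)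

(* Defs.v *)
From mathcomp Require Import all_boot all_order all_algebra.
From mathcomp Require Import all_classical all_reals all_analysis.
From mathcomp.real_closed Require Export complex.
Export numFieldNormedType.Exports.

Set Implicit Arguments.
Unset Strict Implicit.
Unset Printing Implicit Defensive.

Import Order.TTheory GRing.Theory Num.Theory.
Local Open Scope classical_set_scope.
Local Open Scope complex_scope.
Local Open Scope ring_scope.

Reserved Notation "g ∘ f" (at level 40, left associativity).
Reserved Notation "A ⊗ B" (at level 40, left associativity).
Reserved Notation "f ⊠ g" (at level 40, left associativity).

Declare Scope cat_scope.
Delimit Scope cat_scope with cat.
Local Open Scope cat_scope.

Record preaddCat := PreaddCat {
  obj :> Type;
  hom : obj -> obj -> zmodType;
  idm : forall A, hom A A;
  comp : forall A B C, hom B C -> hom A B -> hom A C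
    where "g ∘ f" := (comp g f);
  compA : forall A B C D (f : hom A B) (g : hom B C) (h : hom C D),
    h ∘ (g ∘ f) = (h ∘ g) ∘ f;
  comp1m : forall A B (f : hom A B), idm B ∘ f = f;
  compm1 : forall A B (f : hom A B), f ∘ idm A = f;
  compDl : forall A B C (g g' : hom B C) (f : hom A B),
    (g + g') ∘ f = g ∘ f + g' ∘ f;
  compDr : forall A B C (g : hom B C) (f f' : hom A B),
    g ∘ (f + f') = g ∘ f + g ∘ f'
}.
Arguments hom {p} A B.
Arguments idm {p} A.
Arguments comp {p A B C} g f.
Notation "g ∘ f" := (comp g f) : cat_scope.

Definition is_inverse (C : preaddCat) (A B : C) (f : hom A B) (g : hom B A) :=
  g ∘ f = idm A /\ f ∘ g = idm B.

Definition is_iso (C : preaddCat) (A B : C) (f : hom A B) :=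
  exists g : hom B A, is_inverse f g.

Definition isomorphic (C : preaddCat) (A B : C) :=
  exists f : hom A B, is_iso f.

Definition is_zero_obj (C : preaddCat) (A : C) := idm A = 0.

(* For n = 0 this says that A is a zero object. *)
Definition is_biproduct (C : preaddCat) (n : nat) (F : 'I_n -> C) (A : C) :=
  exists (inj : forall i, hom (F i) A) (prj : forall i, hom A (F i)),
    [/\ forall i, prj i ∘ inj i = idm (F i),
        forall i j, i != j -> prj j ∘ inj i = 0 &
        \sum_(i < n) inj i ∘ prj i = idm A].

Definition additive_cat (C : preaddCat) :=
  forall (n : nat) (F : 'I_n -> C), exists A : C, is_biproduct F A.

Definition indecomposable (C : preaddCat) (A : C) :=
  ~ is_zero_obj A /\
  forall F : 'I_2 -> C, is_biproduct F A -> exists i, is_zero_obj (F i).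

(* The ring hom A A is local: it is nonzero and its non-units are closed
   under addition. *)
Definition local_end (C : preaddCat) (A : C) :=
  idm A <> 0 /\
  forall f g : hom A A, is_iso (f + g) -> is_iso f \/ is_iso g.

Definition krull_schmidt (C : preaddCat) :=
  forall A : C, exists (n : nat) (F : 'I_n -> C),
    is_biproduct F A /\ forall i, local_end (F i).

Definition finitely_many_indec (C : preaddCat) :=
  exists (n : nat) (F : 'I_n -> C),
    forall A : C, indecomposable A -> exists i, isomorphic A (F i).

Record monCat := MonCat {
  monCat_cat :> preaddCat;
  unitob : monCat_cat;
  tens : monCat_cat -> monCat_cat -> monCat_cat
    where "A ⊗ B" := (tens A B);
  tensm : forall A B A' B' : monCat_cat,
    hom A B -> hom A' B' -> hom (A ⊗ A') (B ⊗ B')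
    where "f ⊠ g" := (tensm f g);
  tensm1 : forall A B, idm A ⊠ idm B = idm (A ⊗ B);
  tensmC : forall (A B D A' B' D' : monCat_cat)
      (g : hom B D) (f : hom A B) (g' : hom B' D') (f' : hom A' B'),
    (g ∘ f) ⊠ (g' ∘ f') = (g ⊠ g') ∘ (f ⊠ f');
  tensmDl : forall (A B A' B' : monCat_cat) (f g : hom A B) (h : hom A' B'),
    (f + g) ⊠ h = f ⊠ h + g ⊠ h;
  tensmDr : forall (A B A' B' : monCat_cat) (h : hom A B) (f g : hom A' B'),
    h ⊠ (f + g) = h ⊠ f + h ⊠ g;
  assoc : forall A B D, hom ((A ⊗ B) ⊗ D) (A ⊗ (B ⊗ D));
  lunit : forall A, hom (unitob ⊗ A) A;
  runit : forall A, hom (A ⊗ unitob) A;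
  assoc_iso : forall A B D, is_iso (assoc A B D);
  lunit_iso : forall A, is_iso (lunit A);
  runit_iso : forall A, is_iso (runit A);
  assoc_nat : forall (A B D A' B' D' : monCat_cat)
      (f : hom A A') (g : hom B B') (h : hom D D'),
    assoc A' B' D' ∘ ((f ⊠ g) ⊠ h) = (f ⊠ (g ⊠ h)) ∘ assoc A B D;
  lunit_nat : forall (A B : monCat_cat) (f : hom A B),
    lunit B ∘ (idm unitob ⊠ f) = f ∘ lunit A;
  runit_nat : forall (A B : monCat_cat) (f : hom A B),
    runit B ∘ (f ⊠ idm unitob) = f ∘ runit A;
  pentagon : forall A B D E,
    assoc A B (D ⊗ E) ∘ assoc (A ⊗ B) D E =
    (idm A ⊠ assoc B D E) ∘ assoc A (B ⊗ D) E ∘ (assoc A B D ⊠ idm E);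
  triangle : forall A B,
    (idm A ⊠ lunit B) ∘ assoc A unitob B = runit A ⊠ idm B
}.
Arguments unitob {m}.
Arguments tens {m} A B.
Notation "A ⊗ B" := (tens A B) : cat_scope.

Record finMonCat := FinMonCat {
  finMonCat_cat :> monCat;
  fmc_additive : additive_cat finMonCat_cat;
  fmc_krull_schmidt : krull_schmidt finMonCat_cat;
  fmc_finite : finitely_many_indec finMonCat_cat;
  fmc_unit_indec : indecomposable (@unitob finMonCat_cat)
}.

Fixpoint tpow (C : monCat) (X : C) (n : nat) : C :=
  if n is n'.+1 then X ⊗ tpow X n' else unitob.

Definition is_indec_reps (C : monCat) (r : nat) (I : 'I_r.+1 -> C) :=
  [/\ I ord0 = unitob,
      forall i, indecomposable (I i),
      forall i j, isomorphic (I i) (I j) -> i = j &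
      forall A : C, indecomposable A -> exists i, isomorphic A (I i)].

Definition is_decomp (C : preaddCat) (r : nat) (I : 'I_r -> C) (A : C)
    (s : seq 'I_r) :=
  is_biproduct (fun i => I (tnth (in_tuple s) i)) A.

(* The multiset of indices is unique by the Krull-Schmidt theorem; decompP
   below shows that the default value [::] is not used. *)
Definition decomp (C : preaddCat) (r : nat) (I : 'I_r -> C) (A : C) :
    seq 'I_r :=
  xget [::] [set s | is_decomp I A s].

Section DecompExists.
Variable C : preaddCat.
Implicit Types A B D : C.

Let comp0m A B D (f : hom A B) : (0 : hom B D) ∘ f = 0.
Proof. by apply: (@addrI _ (0 ∘ f)); rewrite -compDl !addr0. Qed.

Let compm0 A B D (f : hom B D) : f ∘ (0 : hom A B) = 0.
Proof. by apply: (@addrI _ (f ∘ 0)); rewrite -compDr !addr0. Qed.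

Lemma local_end_indecomposable A : local_end A -> indecomposable A.
Proof.
case=> nz loc; split=> // F [inj [prj [h1 h0 hs]]].
have isoid : is_iso (idm A) by exists (idm A); split; rewrite comp1m.
have key i : is_iso (inj i ∘ prj i) -> inj i ∘ prj i = idm A.
  set e := inj i ∘ prj i => -[g [ge eg]].
  have ee : e ∘ e = e by rewrite /e compA -[inj i ∘ _ ∘ _]compA h1 compm1.
  by rewrite -[LHS]comp1m -ge -compA ee.
have fin i j : j != i -> inj i ∘ prj i = idm A -> is_zero_obj (F j).
  move=> ji ei; rewrite /is_zero_obj -h1 -[inj j]comp1m -ei -compA h0 //.
  by rewrite !compm0.
move: hs; rewrite big_ord_recr big_ord_recr big_ord0 /= add0r => hs.
move: isoid; rewrite -hs => /loc [] /key /fin H.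
- by exists ord_max; apply: H.
- by exists (widen_ord (leqnSn 1) ord_max); apply: H.
Qed.

Lemma is_biproduct_iso n (F G : 'I_n -> C) A :
  (forall i, isomorphic (F i) (G i)) -> is_biproduct F A -> is_biproduct G A.
Proof.
move=> FG [inj [prj [h1 h0 hs]]].
have /all_tag[f /all_tag[g fg]] i :
    {f : hom (F i) (G i) & {g : hom (G i) (F i) & is_inverse f g}}.
  by have /cid[f /cid[g fg]] := FG i; exists f, g.
exists (fun i => inj i ∘ g i), (fun i => f i ∘ prj i); split.
- move=> i; have [_ fgi] := fg i.
  by rewrite compA -[f i ∘ _ ∘ _]compA h1 compm1.
- move=> i j ij; rewrite compA -[f j ∘ _ ∘ _]compA h0 //.
  by rewrite compm0 comp0m.
- rewrite -hs; apply: eq_bigr => i _; have [gfi _] := fg i.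
  by rewrite compA -[inj i ∘ _ ∘ _]compA gfi compm1.
Qed.

Lemma is_biproduct_reindex m n (h : 'I_m -> 'I_n) (F : 'I_n -> C) A :
  bijective h -> is_biproduct F A -> is_biproduct (fun i => F (h i)) A.
Proof.
move=> bh [inj [prj [h1 h0 hs]]].
exists (fun i => inj (h i)), (fun i => prj (h i)); split=> //.
- by move=> i j ij; apply: h0; rewrite (inj_eq (bij_inj bh)).
- by rewrite -hs (reindex h) //; apply: onW_bij.
Qed.

Lemma decompP (r : nat) (I : 'I_r -> C) A :
  krull_schmidt C ->
  (forall B, indecomposable B -> exists i, isomorphic B (I i)) ->
  is_decomp I A (decomp I A).
Proof.
move=> KS reps; rewrite /decomp.
suff [s hs] : exists s, is_decomp I A s.
  exact: (@xgetPex _ [::] [set s | is_decomp I A s] (ex_intro _ s hs)).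
have [n [F [bF loc]]] := KS A.
have /choice[g gP] i : exists k, isomorphic (F i) (I k).
  exact/reps/local_end_indecomposable/loc.
have {}bF := is_biproduct_iso gP bF.
set s := map g (enum 'I_n).
have szs : size s = n by rewrite size_map size_enum_ord.
exists s; rewrite /is_decomp.
have -> : (fun i => I (tnth (in_tuple s) i)) = (fun i => I (g (cast_ord szs i))).
  apply/funext => i; congr I.
  rewrite (tnth_nth (g (cast_ord szs i))) (nth_map (cast_ord szs i)).
    by rewrite -[X in nth _ _ X]/(nat_of_ord (cast_ord szs i)) nth_ord_enum.
  by rewrite size_enum_ord -[X in (_ < X)%N]szs.
apply: (is_biproduct_reindex _ bF).
by exists (cast_ord (esym szs)); [exact: cast_ordK | exact: cast_ordKV].
Qed.

End DecompExists.

Section Action.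
Variables (C : monCat) (r : nat) (I : 'I_r.+1 -> C) (X : C).

Definition mult (k : 'I_r.+1) (A : C) : nat := count_mem k (decomp I A).

Definition nb_summands (n : nat) : nat := size (decomp I (tpow X n)).

(* Left tensoring: the j-th column records the summands of X ⊗ I j. *)
Definition pre_action_mx : 'M[nat]_r.+1 := \matrix_(k, j) mult k (X ⊗ I j).

Definition unit_component : {set 'I_r.+1} :=
  [set j in connect
     (fun k j => (pre_action_mx k j != 0%N) || (pre_action_mx j k != 0%N)) ord0].

Definition action_mx : 'M[nat]_#|unit_component| :=
  mxsub enum_val enum_val pre_action_mx.

Lemma unit_in_component : ord0 \in unit_component.
Proof. by rewrite inE; apply: connect0. Qed.

Definition unit_index : 'I_#|unit_component| :=
  enum_rank_in unit_in_component ord0.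

Lemma unit_index0 : unit_index = 0%N :> nat.
Proof.
have E : enum unit_component = ord0 ::
    [seq x <- map (lift ord0) (enum 'I_r) | x \in unit_component].
  by rewrite {1}/enum_mem -enumT enum_ordSl /= unit_in_component.
have lt0 : (0 < #|unit_component|)%N by rewrite cardE E.
suff -> : unit_index = Ordinal lt0 by [].
rewrite /unit_index -[RHS](enum_valK_in unit_in_component); congr enum_rank_in.
by rewrite (enum_val_nth ord0) E.
Qed.

End Action.

Section Asymptotics.
Variable R : realType.

(* exp (2 * pi * i / h) *)
Definition rootu (h : nat) : R[i] :=
  cos (2 * pi / h%:R) +i* sin (2 * pi / h%:R).

Definition cmx (m : nat) (M : 'M[nat]_m) : 'M[R[i]]_m :=
  map_mx (fun a => a%:R) M.

Local Notation normc := (@Normc.normc R).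

(* The multiplicity is algebraic: the order of pf as a root of char_poly M. *)
Definition perron_frobenius (m : nat) (M : 'M[R[i]]_m) (pf : R) (h : nat) :=
  [/\ 0 < pf,
      eigenvalue M pf%:C /\ (forall mu, eigenvalue M mu -> normc mu <= pf),
      mup pf%:C (char_poly M) = 1%N,
      (0 < h)%N &
      forall mu : R[i],
        (eigenvalue M mu /\ normc mu = pf /\ mu <> pf%:C) <->
        (exists2 k : nat, (0 < k < h)%N & mu = rootu h ^+ k * pf%:C)].

(* lsec = 0 by convention when no eigenvalue is smaller than pf in modulus. *)
Definition second_eigenvalue (m : nat) (M : 'M[R[i]]_m) (pf : R)
    (lsec : R[i]) :=
  [/\ eigenvalue M lsec, normc lsec < pf &
      forall mu, eigenvalue M mu -> normc mu < pf -> normc mu <= normc lsec]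
  \/ ((forall mu, eigenvalue M mu -> ~ normc mu < pf) /\ lsec = 0).

Definition col_sum (m : nat) (A : 'M[R[i]]_m) (j : 'I_m) : R[i] :=
  \sum_(i < m) A i j.

(* Since x / 0 = 0, convergence of the quotient to 1 forces g n <> 0 for all
   large n. *)
Definition asym_equiv (f g : nat -> R[i]) :=
  (fun n => f n / g n) @ \oo --> (1 : R[i]^o).

(* Finitely many terms do not affect boundedness, so the values f n for small
   n are irrelevant. *)
Definition geometric_cvg (f : nat -> R[i]) (a : R[i]) (beta : R) :=
  forall gamma : R, beta < gamma -> gamma < 1 ->
    bounded_fun (fun n => (f n - a) / gamma%:C ^+ n : R[i]^o).

End Asymptotics.

(* Main.v *)
Require Import Defs.
From mathcomp Require Import all_boot all_order all_algebra.
From mathcomp Require Import all_classical all_reals all_analysis.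
From mathcomp Require Import ring lra.

(* Krull-Schmidt uniqueness makes multiplicities additive, so with 1 the
   all-one row, M = M(X) and e_0 the basis vector of the unit,
   b(n) = 1 M^n e_0; moreover the j-th column sum of M^n is the number of
   summands of X^n ⊗ X_j, hence at most K b(n) for a constant K.  Pairing
   with a left eigenvector for PFdim X gives PFdim(X)^n <= K' b(n).

   The traces of the M^n are nonnegative power sums of the eigenvalues.
   Twisting such power sums by a unimodular z and averaging over n shows that
   an eigenvalue of modulus PFdim X has algebraic multiplicity at most that
   of PFdim X, which is one.

   Hence N = M - sum_k lambda_k v_k w_k^T only has eigenvalues of modulus
   smaller than PFdim X, by Sylvester's determinant identity, and the error
   b(n) - a(n) = 1 N^n (1 - sum_k v_k w_k^T) e_0 decays at the claimed rate,
   by Cayley-Hamilton.  The lower bound on b(n) keeps a(n) away from 0. *)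

Set Implicit Arguments.
Unset Strict Implicit.
Unset Printing Implicit Defensive.

Import Order.TTheory GRing.Theory Num.Theory.
Local Open Scope classical_set_scope.
Local Open Scope complex_scope.
Local Open Scope ring_scope.
Local Open Scope cat_scope.

Local Notation hom := Defs.hom.
Local Notation compA := Defs.compA.

(** * Powers and characteristic polynomials *)

Lemma char_poly_conj (F : fieldType) m (P A : 'M[F]_m) :
  P \in unitmx -> char_poly (P *m A *m invmx P) = char_poly A.
Proof.
move=> uP; pose Q := map_mx (@polyC F).
have QP : Q _ _ P *m Q _ _ (invmx P) = 1%:M.
  by rewrite -map_mxM mulmxV // map_mx1.
rewrite /char_poly /char_poly_mx !map_mxM /= -/(Q m m).
have -> : 'X%:M - Q _ _ P *m Q _ _ A *m Q _ _ (invmx P) =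
    Q _ _ P *m ('X%:M - Q _ _ A) *m Q _ _ (invmx P).
  rewrite mulmxBr mulmxBl; congr (_ - _).
  by rewrite scalar_mxC -mulmxA QP mulmx1.
by rewrite !det_mulmx mulrAC -det_mulmx QP det1 mul1r.
Qed.

Lemma trig_mxM (F : pzRingType) m (A B : 'M[F]_m) :
  is_trig_mx A -> is_trig_mx B ->
  is_trig_mx (A *m B) /\ forall i, (A *m B) i i = A i i * B i i.
Proof.
move=> /is_trig_mxP tA /is_trig_mxP tB; split.
  apply/is_trig_mxP => i j ij; rewrite mxE big1 // => k _.
  have [ik|ki] := ltnP i k; first by rewrite tA // mul0r.
  by rewrite tB ?mulr0 // (leq_ltn_trans ki).
move=> i; rewrite mxE (bigD1 i) //= big1 ?addr0 // => k; rewrite neq_ltn.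
by case/orP => ki; [rewrite tB ?mulr0 | rewrite tA ?mul0r].
Qed.

Lemma trig_mxX (F : pzRingType) m (A : 'M[F]_m) n :
  is_trig_mx A -> is_trig_mx (A ^+ n) /\ forall i, (A ^+ n) i i = A i i ^+ n.
Proof.
move=> tA; elim: n => [|n [tAn IH]].
  rewrite expr0; split=> [|i]; last by rewrite mxE eqxx expr0.
  by apply/is_trig_mxP => i j ij; rewrite mxE -val_eqE ltn_eqF.
rewrite exprS; have [t d] := trig_mxM tA tAn; split=> // i.
by rewrite exprS -IH -d.
Qed.

Lemma mxtrace_exp (F : numClosedFieldType) m (A : 'M[F]_m) :
  exists2 s : seq F, char_poly A = \prod_(mu <- s) ('X - mu%:P) &
    forall n, \tr (A ^+ n) = \sum_(mu <- s) mu ^+ n.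
Proof.
case: m => [|m] in A *.
  exists [::] => [|n]; last by rewrite big_nil /mxtrace big_ord0.
  by rewrite big_nil /char_poly det_mx00.
have [P /unitarymx_unit uP] := Schur A (ltn0Sn m).
rewrite /similar_to /= conjumx // => tT; set T := P *m A *m _ in tT.
exists [seq T i i | i <- enum 'I_m.+1] => [|n].
  by rewrite big_map big_enum /= -char_poly_trig // char_poly_conj.
rewrite big_map big_enum /=.
under [RHS]eq_bigr => i _ do rewrite -(trig_mxX n tT).2.
rewrite -[RHS]/(\tr (T ^+ n)).
suff -> : T ^+ n = P *m A ^+ n *m invmx P.
  by rewrite mxtrace_mulC mulmxA mulVmx // mul1mx.
elim: n => [|n IH]; first by rewrite !expr0 mulmx1 mulmxV.
rewrite !exprS IH -[LHS]/(T *m _) -[A * _]/(A *m _) /T.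
by rewrite !mulmxA mulmxKV.
Qed.

(* Sylvester's identity: both sides equal t^h times the determinant of the
   block matrix [[t, V], [W, 1]]. *)
Lemma det_sub_mulmxC (F : comNzRingType) m h (V : 'M[F]_(m, h))
    (W : 'M[F]_(h, m)) (t : F) :
  \det (t%:M - V *m W) * t ^+ h = t ^+ m * \det (t%:M - W *m V).
Proof.
pose P := block_mx (t%:M : 'M[F]_m) V W (1%:M : 'M[F]_h).
have E1 : P *m block_mx 1%:M 0 (- W) 1%:M = block_mx (t%:M - V *m W) V 0 1%:M.
  rewrite /P mulmx_block !mulmx1 !mulmx0 !add0r !mulmxN ?mul1mx.
  by rewrite subrr.
have E2 : block_mx 1%:M 0 (- W) t%:M *m P = block_mx t%:M V 0 (t%:M - W *m V).
  rewrite /P mulmx_block !mul1mx !mulmx1 !mul0mx !addr0 !mulNmx scalar_mxC addNr.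
  by rewrite addrC.
move/(congr1 determinant): E1; rewrite det_mulmx det_lblock det_ublock.
rewrite !det1 !mulr1 => <-.
move/(congr1 determinant): E2; rewrite det_mulmx det_lblock det_ublock.
by rewrite det1 mul1r !det_scalar mulrC.
Qed.

Lemma char_poly_deflate (F : fieldType) m h (M : 'M[F]_m)
    (V : 'M[F]_(m, h)) (W : 'M[F]_(h, m)) (d : 'rV[F]_h) :
  M *m V = V *m diag_mx d -> W *m V = 1%:M ->
  char_poly (M - V *m diag_mx d *m W) * \prod_(k < h) ('X - (d 0 k)%:P) =
  'X ^+ h * char_poly M.
Proof.
move=> MV WV; set N := M - _; pose Q := map_mx (@polyC F).
have NV : N *m V = 0 by rewrite mulmxBl MV -!mulmxA WV mulmx1 subrr.
set E := V *m diag_mx d *m W in N NV *.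
have QE : Q _ _ N *m Q _ _ E = 0.
  by rewrite -map_mxM /E !mulmxA NV !mul0mx map_mx0.
have XM : char_poly_mx N *m ('X%:M - Q _ _ E) = 'X *: char_poly_mx M.
  rewrite /char_poly_mx -/(Q m m) mulmxBr mul_mx_scalar mulmxBl QE subr0.
  by rewrite mul_scalar_mx -scalerBr -addrA -opprD -map_mxD subrK.
have := congr1 determinant XM; rewrite det_mulmx detZ => {}XM.
have := det_sub_mulmxC (Q _ _ (V *m diag_mx d)) (Q _ _ W) 'X.
rewrite -!map_mxM mulmxA WV mul1mx -/E.
have -> : \det ('X%:M - Q _ _ (diag_mx d)) = \prod_(k < h) ('X - (d 0 k)%:P).
  rewrite -[LHS]/(char_poly _) char_poly_trig ?diag_mx_is_trig //.
  by apply: eq_bigr => k _; rewrite mxE eqxx.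
move=> SY; apply: (@mulfI _ ('X ^+ m)); first by rewrite expf_neq0 ?polyX_eq0.
rewrite mulrCA -SY mulrA XM -[\det _]/(char_poly M).
by rewrite mulrAC -!mulrA mulrCA; congr (_ * _); rewrite mulrC.
Qed.

Lemma linear_recurrence_bound (F : numFieldType) (u : nat -> F) (mu g K : F) :
  `|mu| < g -> (forall n, `|u n.+1 - mu * u n| <= K * g ^+ n) ->
  exists K', forall n, `|u n| <= K' * g ^+ n.
Proof.
move=> mug uK; exists (`|u 0%N| + K / (g - `|mu|)).
have K0 : 0 <= K by have := le_trans (normr_ge0 _) (uK 0%N); rewrite mulr1.
have g0 : 0 < g by apply: le_lt_trans mug.
have d0 : 0 < g - `|mu| by rewrite subr_gt0.
elim=> [|n IH]; first by rewrite mulr1 lerDl divr_ge0 // ltW.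
rewrite -[u n.+1](subrK (mu * u n)) (le_trans (ler_normD _ _)) // normrM.
apply: le_trans (lerD (uK n) (ler_wpM2l (normr_ge0 mu) IH)) _.
rewrite exprS !mulrA -mulrDl ler_wpM2r ?exprn_ge0 ?(ltW g0) //.
set q := K / _; have {1}-> : K = q * (g - `|mu|) by rewrite divfK ?gt_eqF.
rewrite [in leLHS]mulrC -subr_ge0.
have -> : (`|u 0%N| + q) * g - ((g - `|mu|) * q + `|mu| * (`|u 0%N| + q)) =
   `|u 0%N| * (g - `|mu|) by ring.
by rewrite mulr_ge0 // ltW.
Qed.

Lemma mx_pow_bound (F : numClosedFieldType) m (N : 'M[F]_m) (g : F)
    (w : 'rV_m) (x : 'cV_m) :
  (forall mu, root (char_poly N) mu -> `|mu| < g) ->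
  exists K, forall n, `|(w *m N ^+ n *m x) 0 0| <= K * g ^+ n.
Proof.
case: m => [|m] in N w x *.
  by exists 0 => n; rewrite mul0r mxE big_ord0 normr0.
move=> small.
pose u p n := (w *m (N ^+ n *m horner_mx N p) *m x) 0 0.
suff [K uK] : exists K, forall n, `|u 1 n| <= K * g ^+ n.
  by exists K => n; have := uK n; rewrite /u rmorph1 mulmx1.
have [s Ns _] := mxtrace_exp N.
have {}small mu : mu \in s -> `|mu| < g.
  by move=> mus; apply: small; rewrite Ns root_prod_XsubC.
have Ns0 : exists K, forall n,
    `|u (1 * \prod_(mu <- s) ('X - mu%:P)) n| <= K * g ^+ n.
  exists 0 => n; rewrite mul1r -Ns /u.
  by rewrite (Cayley_Hamilton N) mulmx0 mulmx0 mul0mx mxE normr0 mul0r.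
suff step p : (exists K, forall n,
    `|u (p * \prod_(mu <- s) ('X - mu%:P)) n| <= K * g ^+ n) ->
    exists K, forall n, `|u p n| <= K * g ^+ n by apply: step.
elim: s p small {Ns Ns0} => [|mu s IH] p small; first by rewrite big_nil mulr1.
rewrite big_cons mulrA => /IH[nu nus|K uK].
  by apply: small; rewrite inE nus orbT.
apply: (@linear_recurrence_bound _ _ mu g K) => [|n].
  by apply: small; rewrite mem_head.
suff <- : u (p * ('X - mu%:P)) n = u p n.+1 - mu * u p n by [].
rewrite /u rmorphM rmorphB /= horner_mx_X horner_mx_C.
have -> : N ^+ n *m (horner_mx N p * (N - mu%:M)) =
    N ^+ n.+1 *m horner_mx N p - mu *: (N ^+ n *m horner_mx N p).
  rewrite -[_ * _]/(_ *m _) mulmxBr mulmxBr mul_mx_scalar -scalemxAr.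
  congr (_ - _); rewrite exprSr -[N ^+ n * N]/(_ *m _) -[RHS]mulmxA.
  by congr (_ *m _); apply: comm_horner_mx.
by rewrite mulmxBr mulmxBl -scalemxAr -scalemxAl !mxE.
Qed.

Lemma geometric_sum_bound (F : numFieldType) (mu : F) :
  `|mu| <= 1 -> exists B, forall L,
  `|\sum_(n < L) mu ^+ n - ((mu == 1)%:R * L%:R)| <= B.
Proof.
move=> mu1; have [->|nmu] := eqVneq mu 1.
  exists 0 => L; under eq_bigr => n _ do rewrite expr1n.
  by rewrite sumr_const card_ord mul1r subrr normr0.
exists (2 / `|mu - 1|) => L; rewrite mul0r subr0.
rewrite ler_pdivlMr ?normr_gt0 ?subr_eq0 // mulrC -normrM -subrX1.
rewrite (le_trans (ler_normB _ _)) // normr1 normrX -natr1 lerD2r.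
by rewrite exprn_ile1.
Qed.

(* The mean of z^-n times the n-th power sum converges to the multiplicity
   of z in s. *)
Lemma power_sum_mean (F : numFieldType) (s : seq F) (z : F) :
  {in s, forall mu, `|mu| <= 1} -> `|z| = 1 ->
  exists B, forall L, `|\sum_(n < L) (z^-1 ^+ n * \sum_(mu <- s) mu ^+ n)
                       - (count_mem z s)%:R * L%:R| <= B.
Proof.
move=> s1 z1; have z0 : z != 0 by rewrite -normr_eq0 z1 oner_eq0.
elim: s s1 => [|mu s IH] s1.
  exists 0 => L; rewrite mul0r subr0 big1 ?normr0 // => n _.
  by rewrite big_nil mulr0.
have [nu nus|B HB] := IH; first by apply: s1; rewrite inE nus orbT.
have [|B' HB'] := @geometric_sum_bound _ (z^-1 * mu).
  by rewrite normrM normfV z1 invr1 mul1r s1 ?mem_head.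
exists (B' + B) => L; apply: le_trans (lerD (HB' L) (HB L)).
apply: le_trans (ler_normD _ _).
rewrite le_eqVlt; apply/orP; left; apply/eqP; congr `| _ |.
under eq_bigr => n _ do rewrite big_cons mulrDr -exprMn.
rewrite big_split /= natrD mulrDl opprD addrACA.
suff -> : (z^-1 * mu == 1) = (mu == z) by [].
by rewrite mulrC; apply/eqP/eqP => [|->]; [move/divr1_eq | rewrite divff].
Qed.

Lemma count_unimodular_le (R : realType) (s : seq R[i]) (z : R[i]) :
  {in s, forall mu, `|mu| <= 1} -> `|z| = 1 ->
  (forall n, 0 <= \sum_(mu <- s) mu ^+ n) ->
  (count_mem z s <= count_mem 1%R s)%N.
Proof.
move=> s1 z1 s0; rewrite leqNgt; apply/negP => lt1z.
have [B HB] := power_sum_mean s1 z1.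
have [B' HB'] := power_sum_mean s1 (normr1 R[i]).
have LB L : (L%:R : R[i]) <= B + B'.
  have := lerD (HB L) (HB' L); apply: le_trans.
  set T := \sum_(n < L) _; set T' := \sum_(n < L) _.
  have TT' : `|T| <= T'.
    apply: le_trans (ler_norm_sum _ _ _) _.
    apply: ler_sum => n _; rewrite normrM invr1 expr1n mul1r.
    by rewrite normrX normfV z1 invr1 expr1n mul1r ger0_norm.
  have T'0 : 0 <= T' := le_trans (normr_ge0 _) TT'.
  set c := (count_mem z s)%:R * _; set c1 := (count_mem 1%R s)%:R * _.
  have c0 : 0 <= c by rewrite mulr_ge0.
  have c10 : 0 <= c1 by rewrite mulr_ge0.
  have A1 : c - `|T| <= `|T - c|.
    by rewrite distrC -{1}(ger0_norm c0) lerB_dist.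
  have A2 : T' - c1 <= `|T' - c1| by rewrite real_ler_norm // realB ?ger0_real.
  apply: le_trans (lerD A1 A2).
  have A3 : c1 + L%:R <= c.
    by rewrite /c /c1 -!natrM -natrD ler_nat addnC -mulSn leq_mul2r lt1z orbT.
  have -> : c - `|T| + (T' - c1) = (c - c1) + (T' - `|T|) by ring.
  by rewrite -[leLHS]addr0 lerD ?subr_ge0 // lerBrDl.
have B0 : 0 <= B + B' by have := LB 0%N.
have [r Br] : exists r : R, B + B' = r%:C.
  by exists (complex.Re (B + B')); rewrite RRe_real // ger0_real.
have := LB (Num.truncn r).+1; rewrite Br -(rmorph_nat (real_complex R)) lecR.
by rewrite leNgt truncnS_gt.
Qed.

Lemma mup_char_poly_le (R : realType) m (M : 'M[R[i]]_m) (pf z : R[i]) :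
  0 < pf -> (forall n, 0 <= \tr (M ^+ n)) ->
  (forall mu, root (char_poly M) mu -> `|mu| <= pf) -> `|z| = pf ->
  (mup z (char_poly M) <= mup pf (char_poly M))%N.
Proof.
move=> pf0 tr0 Mpf zpf; have [s Ms trs] := mxtrace_exp M.
rewrite Ms !mu_prod_XsubC; have pfn0 := lt0r_neq0 pf0.
have cnt x : count_mem x s = count_mem (x / pf) [seq mu / pf | mu <- s].
  rewrite count_map; apply: eq_count => mu /=.
  by rewrite (inj_eq (mulIf _)) ?invr_eq0.
rewrite !cnt divff //; apply: count_unimodular_le.
- move=> _ /mapP[mu mus ->]; rewrite normrM normfV (gtr0_norm pf0).
  by rewrite ler_pdivrMr // mul1r Mpf // Ms root_prod_XsubC.
- by rewrite normrM normfV zpf gtr0_norm // divff.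
move=> n; rewrite big_map; under eq_bigr => mu _ do rewrite expr_div_n.
by rewrite -mulr_suml divr_ge0 -?trs // exprn_ge0 ?ltW.
Qed.

(** * Krull-Schmidt uniqueness *)

Lemma ordS_dep n (P : 'I_n.+1 -> Type) (i0 : 'I_n.+1)
    (a : P i0) (b : forall j, P (lift i0 j)) :
  {f : forall i, P i | f i0 = a /\ forall j, f (lift i0 j) = b j}.
Proof.
pose f i : P i := match unliftP i0 i with
  | UnliftSome j e => ecast x (P x) (esym e) (b j)
  | UnliftNone e => ecast x (P x) (esym e) a
  end.
exists f; split=> [|j]; rewrite /f.
  case: unliftP => [j e|e]; last by rewrite eq_axiomK.
  by case/eqP: (neq_lift i0 j).
case: unliftP => [k e|e]; last by case/eqP: (neq_lift i0 j).
by have kj := lift_inj e; subst k; rewrite eq_axiomK.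
Qed.

Section Preadditive.
Variable C : preaddCat.
Implicit Types A B P Q K L : C.

Lemma comp0m A B K (f : hom A B) : (0 : hom B K) ∘ f = 0.
Proof. by apply: (@addrI _ (0 ∘ f)); rewrite -compDl !addr0. Qed.

Lemma compm0 A B K (f : hom B K) : f ∘ (0 : hom A B) = 0.
Proof. by apply: (@addrI _ (f ∘ 0)); rewrite -compDr !addr0. Qed.

Lemma compmN A B K (f : hom B K) (g : hom A B) : f ∘ (- g) = - (f ∘ g).
Proof. by apply: (@addrI _ (f ∘ g)); rewrite -compDr !subrr compm0. Qed.

Lemma compNm A B K (f : hom B K) (g : hom A B) : (- f) ∘ g = - (f ∘ g).
Proof. by apply: (@addrI _ (f ∘ g)); rewrite -compDl !subrr comp0m. Qed.

Lemma comp_suml A B K n (f : 'I_n -> hom B K) (g : hom A B) :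
  (\sum_i f i) ∘ g = \sum_i f i ∘ g.
Proof.
by apply: (big_morph (fun u => u ∘ g)) => [u v|]; rewrite ?compDl ?comp0m.
Qed.

Lemma comp_sumr A B K n (f : hom B K) (g : 'I_n -> hom A B) :
  f ∘ (\sum_i g i) = \sum_i f ∘ g i.
Proof.
by apply: (big_morph (fun u => f ∘ u)) => [u v|]; rewrite ?compDr ?compm0.
Qed.

Lemma isomorphic_sym A B : isomorphic A B -> isomorphic B A.
Proof. by case=> f [g [gf fg]]; exists g, f. Qed.

Lemma is_iso_comp A B K (g : hom B K) (f : hom A B) :
  is_iso g -> is_iso f -> is_iso (g ∘ f).
Proof.
move=> [g' [gg' g'g]] [f' [ff' f'f]]; exists (f' ∘ g'); split.
  by rewrite compA -[f' ∘ g' ∘ g]compA gg' compm1.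
by rewrite compA -[g ∘ f ∘ f']compA f'f compm1.
Qed.

Definition bip A P Q (i : hom P A) (p : hom A P) (j : hom Q A) (q : hom A Q) :=
  [/\ p ∘ i = idm P, q ∘ j = idm Q, q ∘ i = 0, p ∘ j = 0 &
      i ∘ p + j ∘ q = idm A].

Definition is_bip A P Q := exists i p j q, @bip A P Q i p j q.

Lemma is_biproduct_isor n (F : 'I_n -> C) A B :
  isomorphic A B -> is_biproduct F A -> is_biproduct F B.
Proof.
move=> [f [g [gf fg]]] [inj [prj [h1 h0 hs]]].
exists (fun i => f ∘ inj i), (fun i => prj i ∘ g).
have E i j : prj i ∘ g ∘ (f ∘ inj j) = prj i ∘ inj j.
  by rewrite compA -[_ ∘ g ∘ f]compA gf compm1.
split=> [i|i j ij|]; rewrite ?E //; first exact: h0.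
transitivity (f ∘ (\sum_(i < n) inj i ∘ prj i) ∘ g).
  by rewrite comp_sumr comp_suml; apply: eq_bigr => i _; rewrite !compA.
by rewrite hs compm1.
Qed.

Lemma zero_obj_hom A B (f : hom A B) : is_zero_obj A -> f = 0.
Proof. by rewrite /is_zero_obj => z; rewrite -[f]compm1 z compm0. Qed.

Lemma biproduct_bip n (F : 'I_n.+1 -> C) i0 A B inj prj :
    (forall i, prj i ∘ inj i = idm (F i)) ->
    (forall i j, i != j -> prj j ∘ inj i = 0) ->
    \sum_(i < n.+1) inj i ∘ prj i = idm A ->
  is_biproduct (fun j => F (lift i0 j)) B ->
  exists j q, @bip A (F i0) B (inj i0) (prj i0) j q.
Proof.
move=> h1 h0 hs [jn [pr [g1 g0 gs]]].
exists (\sum_k inj (lift i0 k) ∘ pr k), (\sum_k jn k ∘ prj (lift i0 k)); split.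
- exact: h1.
- rewrite comp_suml -gs; apply: eq_bigr => k _.
  rewrite comp_sumr (bigD1 k) //= big1 => [|l lk].
    by rewrite addr0 compA -[_ ∘ inj _]compA h1 compm1.
  rewrite compA -[_ ∘ inj _]compA h0 ?compm0 ?comp0m //.
  by rewrite (inj_eq lift_inj).
- by rewrite comp_suml big1 // => k _; rewrite -compA h0 ?compm0 // neq_lift.
- rewrite comp_sumr big1 // => k _.
  by rewrite compA h0 ?comp0m // eq_sym neq_lift.
- rewrite -hs (bigD1_ord i0) //=; congr (_ + _).
  rewrite comp_suml; apply: eq_bigr => k _.
  rewrite comp_sumr (bigD1 k) //= big1 => [|l lk].
    by rewrite addr0 compA -[_ ∘ pr k ∘ _]compA g1 compm1.
  by rewrite compA -[_ ∘ pr k ∘ _]compA g0 // compm0 comp0m.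
Qed.

Lemma bip_biproduct n (F : 'I_n.+1 -> C) i0 A B :
  is_bip A (F i0) B -> is_biproduct (fun j => F (lift i0 j)) B ->
  is_biproduct F A.
Proof.
move=> [i [p [j [q [pi qj qi pj ij]]]]] [jn [pr [g1 g0 gs]]].
have [inj [inj0 injS]] := @ordS_dep _ (fun k => hom (F k) A) i0 i
  (fun k => j ∘ jn k).
have [prj [prj0 prjS]] := @ordS_dep _ (fun k => hom A (F k)) i0 p
  (fun k => pr k ∘ q).
have E k l : pr k ∘ q ∘ (j ∘ jn l) = pr k ∘ jn l.
  by rewrite compA -[_ ∘ q ∘ j]compA qj compm1.
exists inj, prj; split=> [k|k l|].
- have [k' ->|->] := unliftP i0 k; last by rewrite inj0 prj0.
  by rewrite injS prjS E.
- have [k' ->|->] := unliftP i0 k; have [l' ->|->] := unliftP i0 l.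
  + by rewrite (inj_eq lift_inj) injS prjS E; apply: g0.
  + by rewrite prj0 injS compA pj comp0m.
  + by rewrite inj0 prjS -compA qi compm0.
  + by rewrite eqxx.
- rewrite (bigD1_ord i0) //= inj0 prj0 -ij; congr (_ + _).
  under eq_bigr => k _ do rewrite injS prjS compA -[j ∘ _ ∘ _]compA.
  by rewrite -comp_suml -comp_sumr gs compm1.
Qed.

Lemma is_biproduct0 (F : 'I_0 -> C) A : is_biproduct F A <-> is_zero_obj A.
Proof.
split=> [[inj [prj [_ _]]]|z]; first by rewrite big_ord0.
have H (P : 'I_0 -> Type) : forall i, P i by case.
exists (H _), (H _); split; [by case | by case | by rewrite big_ord0].
Qed.

Lemma bip_split A P Q i p j q K L (u : hom A L) (v : hom K A) :
  @bip A P Q i p j q -> u ∘ v = u ∘ i ∘ (p ∘ v) + u ∘ j ∘ (q ∘ v).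
Proof.
case=> _ _ _ _ s; rewrite !compA -!compDl -[u ∘ i ∘ p]compA -[u ∘ j ∘ q]compA.
by rewrite -compDr s compm1.
Qed.

(* The isomorphism is the Schur complement of the invertible entry p' ∘ i
   of the matrix of the identity of A. *)
Lemma bip_cancel A P Q P' Q' i p j q i' p' j' q' :
  @bip A P Q i p j q -> @bip A P' Q' i' p' j' q' -> is_iso (p' ∘ i) ->
  isomorphic Q Q'.
Proof.
move=> bA bA' [g [ga ag]]; have [pi qj qi pj ij] := bA.
have [pi' qj' qi' pj' ij'] := bA'.
exists (q' ∘ j - q' ∘ i ∘ g ∘ p' ∘ j), (q ∘ j'); split.
- have E1 : q ∘ j' ∘ (q' ∘ j) = idm Q - q ∘ i' ∘ (p' ∘ j).
    by rewrite -qj (bip_split q j bA') [X in _ = X - _]addrC addrK.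
  have E2 : q ∘ j' ∘ (q' ∘ i) = - (q ∘ i' ∘ (p' ∘ i)).
    by apply/eqP; rewrite -addr_eq0 addrC -(bip_split q i bA') qi.
  rewrite compDr compmN E1 !compA -[q ∘ j' ∘ q' ∘ i]compA E2.
  by rewrite !compNm opprK -[_ ∘ _ ∘ g]compA ag compm1 subrK.
- have E1 : q' ∘ j ∘ (q ∘ j') = idm Q' - q' ∘ i ∘ (p ∘ j').
    by rewrite -qj' (bip_split q' j' bA) [X in _ = X - _]addrC addrK.
  have E2 : p' ∘ j ∘ (q ∘ j') = - (p' ∘ i ∘ (p ∘ j')).
    by apply/eqP; rewrite -addr_eq0 addrC -(bip_split p' j' bA) pj'.
  rewrite compDl compNm E1 -[_ ∘ j ∘ (q ∘ j')]compA -[_ ∘ p' ∘ (j ∘ _)]compA.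
  rewrite [p' ∘ (j ∘ _)]compA E2 compmN opprK [_ ∘ g ∘ _]compA.
  by rewrite -[_ ∘ g ∘ _]compA ga compm1 subrK.
Qed.

Lemma local_end_sum A n (f : 'I_n -> hom A A) :
  local_end A -> is_iso (\sum_i f i) -> exists i, is_iso (f i).
Proof.
move=> [nz loc]; elim: n f => [|n IH] f.
  by rewrite big_ord0 => -[g [g0 _]]; case: nz; rewrite -g0 compm0.
rewrite big_ord_recl => /loc [|H]; first by exists ord0.
have [i fi] := IH (fun i => f (lift ord0 i)) H.
by exists (lift ord0 i).
Qed.

Lemma local_end_split A B (f : hom A B) (g : hom B A) :
  local_end A -> local_end B -> is_iso (g ∘ f) -> is_iso f.
Proof.
move=> [nzA _] [_ locB] [u [uA _]].
have {uA} hf : (u ∘ g) ∘ f = idm A by rewrite -compA.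
move: (u ∘ g) hf => {g u} h hf.
have idem : f ∘ h ∘ (f ∘ h) = f ∘ h.
  by rewrite compA -[f ∘ h ∘ f]compA hf compm1.
have : is_iso (f ∘ h + (idm B - f ∘ h)).
  by rewrite addrC subrK; exists (idm B); split; rewrite comp1m.
have iso_idem (e : hom B B) : e ∘ e = e -> is_iso e -> e = idm B.
  by move=> ee [g [ge _]]; rewrite -[LHS]comp1m -ge -compA ee.
case/locB => /iso_idem.
  by move=> /(_ idem) fh; exists h.
have idem' : (idm B - f ∘ h) ∘ (idm B - f ∘ h) = idm B - f ∘ h.
  by rewrite compDl comp1m compNm compDr compm1 compmN idem subrr oppr0 addr0.
move=> /(_ idem') /eqP; rewrite -subr_eq0 addrAC subrr add0r.
rewrite oppr_eq0 => /eqP fh0; case: nzA.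
by rewrite -[idm A]comp1m -{1}hf -hf compA -[h ∘ f ∘ h]compA fh0 compm0 comp0m.
Qed.

Lemma local_end_iso A B : isomorphic A B -> local_end A -> local_end B.
Proof.
move=> [f [g [gf fg]]] [nz loc]; split=> [z|u v uv].
  by case: nz; rewrite -gf -[f]comp1m z comp0m compm0.
have isof : is_iso f by exists g.
have isog : is_iso g by exists f.
have back w : is_iso (g ∘ w ∘ f) -> is_iso w.
  move=> iw; have -> : w = f ∘ (g ∘ w ∘ f) ∘ g.
    by rewrite -[g ∘ w ∘ f]compA compA fg comp1m -compA fg compm1.
  by apply: is_iso_comp isog; apply: is_iso_comp.
have /loc : is_iso (g ∘ u ∘ f + g ∘ v ∘ f).
  rewrite -compDl -compDr; apply: is_iso_comp isof.
  by apply: is_iso_comp.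
by case=> /back; [left | right].
Qed.

Lemma bip_zero A P Q : is_zero_obj P -> is_bip A P Q -> isomorphic Q A.
Proof.
move=> z [i [p [j [q [_ qj _ _ s]]]]]; exists j, q; split=> //.
by rewrite -s (zero_obj_hom i z) comp0m add0r.
Qed.

Lemma bip_sym A P Q : is_bip A P Q -> is_bip A Q P.
Proof.
move=> [i [p [j [q [? ? ? ? s]]]]]; exists j, q, i, p; split=> //.
by rewrite addrC.
Qed.

Lemma bip_assoc A P Q K P' B :
  is_bip A P Q -> is_bip P K P' -> is_bip B P' Q -> is_bip A K B.
Proof.
move=> [i [p [j [q [pi qj qi pj ij]]]]] [i' [p' [j' [q' [pi' qj' qi' pj' ij']]]]].
move=> [k [r [l [t [rk tl tk rl kl]]]]].
exists (i ∘ i'), (p' ∘ p), (i ∘ j' ∘ r + j ∘ t), (k ∘ q' ∘ p + l ∘ q).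
have R := (compA, comp0m, compm0, compm1, addr0, add0r).
split.
- by rewrite compA -[p' ∘ p ∘ i]compA pi compm1.
- rewrite compDl !compDr !compA.
  rewrite -[k ∘ q' ∘ p ∘ i]compA pi compm1 -[k ∘ q' ∘ j']compA qj' compm1.
  rewrite -[k ∘ q' ∘ p ∘ j]compA pj !R -[l ∘ q ∘ i]compA qi !R.
  by rewrite -[l ∘ q ∘ j]compA qj compm1.
- rewrite compDl !compA -[k ∘ q' ∘ p ∘ i]compA pi compm1 -[k ∘ q' ∘ i']compA.
  by rewrite qi' -[l ∘ q ∘ i]compA qi !R.
- rewrite compDr !compA -[p' ∘ p ∘ i]compA pi compm1 pj'.
  by rewrite -[p' ∘ p ∘ j]compA pj !R.
- rewrite compDl !compDr !compA.
  rewrite -[_ ∘ r ∘ k]compA rk compm1 -[_ ∘ r ∘ l]compA rl.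
  rewrite -[_ ∘ t ∘ k]compA tk -[_ ∘ t ∘ l]compA tl !R addrA.
  by rewrite -[i ∘ i' ∘ p']compA -[i ∘ j' ∘ q']compA -compDl -compDr ij' compm1.
Qed.

End Preadditive.

Section KrullSchmidt.
Variable C : preaddCat.
Hypothesis addC : additive_cat C.
Implicit Types A B P Q K L : C.

Lemma bip_ex P Q : exists A, is_bip A P Q.
Proof.
pose F (i : 'I_2) : C := if i == ord0 then P else Q.
have [A [inj [prj [h1 h0 hs]]]] := addC F.
exists A, (inj ord0), (prj ord0), (inj (lift ord0 ord0)), (prj (lift ord0 ord0)).
split; [exact: (h1 ord0) | exact: (h1 (lift ord0 ord0)) |
  exact: (h0 ord0 (lift ord0 ord0)) | exact: (h0 (lift ord0 ord0) ord0) |].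
by rewrite -hs !big_ord_recl big_ord0 addr0.
Qed.

Lemma biproduct_is_bip n (F : 'I_n.+1 -> C) i0 A :
  is_biproduct F A -> exists B,
    is_bip A (F i0) B /\ is_biproduct (fun j => F (lift i0 j)) B.
Proof.
move=> [inj [prj [h1 h0 hs]]]; have [B bB] := addC (fun j => F (lift i0 j)).
have [j [q bA]] := biproduct_bip h1 h0 hs bB.
by exists B; split=> //; exists (inj i0), (prj i0), j, q.
Qed.

Lemma indecomposable_local_end A :
  krull_schmidt C -> indecomposable A -> local_end A.
Proof.
move=> KS [nz ind]; have [n [F [bF loc]]] := KS A.
case: n => [|n] in F bF loc *; first by case: nz; apply/is_biproduct0/bF.
have [B [bA _]] := biproduct_is_bip ord0 bF.
have [Z bZ] := addC (fun i : 'I_0 => A).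
pose G (i : 'I_2) : C := if i == ord0 then F ord0 else B.
have bG : is_biproduct G A.
  apply: (@bip_biproduct _ _ G ord0 A B) => //.
  apply: (@bip_biproduct _ _ _ ord0 B Z); last first.
    exact/is_biproduct0/is_biproduct0/bZ.
  move/is_biproduct0: bZ => z.
  exists (idm B), (idm B), 0, 0.
  by split; rewrite ?comp1m ?comp0m ?compm0 ?addr0.
have [i zi] := ind G bG.
have {i zi} zB : is_zero_obj B.
  move: zi; rewrite /G; case: ifP => // _ z.
  by case: (loc ord0).
exact: local_end_iso (bip_zero zB (bip_sym bA)) (loc ord0).
Qed.

Lemma perm_eq_lift n (i0 : 'I_n.+1) :
  perm_eq (enum 'I_n.+1) (i0 :: [seq lift i0 j | j <- enum 'I_n]).
Proof.
apply: uniq_perm; rewrite ?enum_uniq //=.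
  rewrite map_inj_uniq ?enum_uniq ?andbT; last exact: lift_inj.
  by apply/mapP => -[j _ /eqP]; rewrite (negPf (neq_lift _ _)).
move=> i; rewrite mem_enum; have [j ->|->] := unliftP i0 i.
  by rewrite in_cons map_f ?mem_enum ?orbT.
by rewrite mem_head.
Qed.

Section Family.
Variables (r : nat) (I : 'I_r -> C).

Lemma is_decomp_tuple n (t : n.-tuple 'I_r) A :
  is_decomp I A t = is_biproduct (fun i => I (tnth t i)) A.
Proof.
case: t => s /= e; have en := eqP e; subst n.
rewrite /is_decomp; congr (is_biproduct _ _); apply/funext => i.
by have x0 := tnth (Tuple e) i; rewrite !(tnth_nth x0).
Qed.

Lemma is_decomp_nil A : is_decomp I A [::] <-> is_zero_obj A.
Proof. exact: is_biproduct0. Qed.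

Lemma is_decomp_cons A k s : is_decomp I A (k :: s) <->
  exists B, is_bip A (I k) B /\ is_decomp I B s.
Proof.
have E : (fun j => I (tnth (in_tuple (k :: s)) (lift ord0 j))) =
         (fun j => I (tnth (in_tuple s) j)).
  by apply/funext => j; rewrite !(tnth_nth k).
split=> [/(@biproduct_is_bip _ _ ord0) [B [bA bB]]|[B [bA bB]]].
  by exists B; split; [exact: bA | rewrite /is_decomp -E].
by apply: (@bip_biproduct _ _ _ ord0 A B); [exact: bA | rewrite E].
Qed.

Hypothesis locI : forall i, local_end (I i).
Hypothesis injI : forall i j, isomorphic (I i) (I j) -> i = j.

Lemma is_decomp_exchange A k B t :
  is_bip A (I k) B -> is_decomp I A t ->
  exists2 t', perm_eq t (k :: t') & is_decomp I B t'.
Proof.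
move=> [i [p [j [q bA]]]] bt; have [pi _ _ _ _] := bA.
have [inj [prj [h1 h0 hs]]] := bt.
have [l isol] : exists l, is_iso (p ∘ inj l ∘ (prj l ∘ i)).
  apply: (local_end_sum (f := fun l => p ∘ inj l ∘ (prj l ∘ i))) => //.
  have -> : \sum_l p ∘ inj l ∘ (prj l ∘ i) = idm (I k).
    rewrite -pi -[p in RHS]compm1 -hs comp_sumr comp_suml.
    by apply: eq_bigr => l _; rewrite !compA.
  by exists (idm (I k)); split; rewrite comp1m.
have isol' := local_end_split (locI k) (locI _) isol.
have ek : k = tnth (in_tuple t) l by apply: injI; exists (prj l ∘ i).
case: t => [|x s] in bt inj prj h1 h0 hs l isol isol' ek *.
  by case: l ek {isol isol'}.
set t := x :: s in bt *.
have [D bD] := addC (fun m : 'I_(size s) => I (tnth (in_tuple t) (lift l m))).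
have [j' [q' bA']] := biproduct_bip h1 h0 hs bD.
have BD := bip_cancel bA bA' isol'.
exists [tuple tnth (in_tuple t) (lift l m) | m < size s].
  have := perm_map (tnth (in_tuple t)) (perm_eq_lift l).
  by rewrite map_tnth_enum /= -ek -map_comp.
rewrite is_decomp_tuple.
have -> : (fun m => I (tnth [tuple tnth (in_tuple t) (lift l m) | m < size s] m)) =
  (fun m : 'I_(size s) => I (tnth (in_tuple t) (lift l m))).
  by apply/funext => m; rewrite tnth_mktuple.
exact: is_biproduct_isor (isomorphic_sym BD) bD.
Qed.

Lemma krull_schmidt_uniq A s t :
  is_decomp I A s -> is_decomp I A t -> perm_eq s t.
Proof.
elim: s A t => [|k s IH] A t.
  move=> /is_decomp_nil zA; case: t => [|k t] // /is_decomp_cons.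
  move=> [B [[i [p [j [q [pi _ _ _ _]]]]] _]].
  by have [] := locI k; rewrite -pi (zero_obj_hom p zA) comp0m.
move=> /is_decomp_cons [B [bA Bs]] /(is_decomp_exchange bA) [t' tt' Bt'].
by rewrite perm_sym (permPl tt') perm_cons perm_sym (IH B).
Qed.

Lemma is_decomp_cat A P Q s t :
  is_bip A P Q -> is_decomp I P s -> is_decomp I Q t -> is_decomp I A (s ++ t).
Proof.
elim: s A P => [|k s IH] A P bA.
  move=> /is_decomp_nil zP; apply: is_biproduct_isor.
  exact: bip_zero zP bA.
move=> /is_decomp_cons [P' [bP Ps]] Qt; apply/is_decomp_cons.
have [B bB] := bip_ex P' Q; exists B; split; last exact: IH bB Ps Qt.
exact: bip_assoc bA bP bB.
Qed.

End Family.
End KrullSchmidt.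

(** * Multiplicities of tensor powers *)

Lemma sum_count_mem (r : nat) (s : seq 'I_r) (f : 'I_r -> nat) :
  (\sum_(j <- s) f j = \sum_j count_mem j s * f j)%N.
Proof.
elim: s => [|k s IH]; first by rewrite big_nil big1.
rewrite big_cons IH; under [RHS]eq_bigr do rewrite /= mulnDl.
rewrite big_split /= [X in (_ = X + _)%N](bigD1 k) //= eqxx mul1n.
rewrite [X in (_ + X + _)%N]big1 ?addn0 // => j jk.
by rewrite eq_sym (negPf jk).
Qed.

Section Tensor.
Variable C : monCat.
Implicit Types A B P Q X : C.

Lemma tensm0 A B A' B' (f : hom A B) : tensm f (0 : hom A' B') = 0.
Proof. by apply: (@addrI _ (tensm f 0)); rewrite -tensmDr !addr0. Qed.

Lemma tens0m A B A' B' (f : hom A' B') : tensm (0 : hom A B) f = 0.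
Proof. by apply: (@addrI _ (tensm 0 f)); rewrite -tensmDl !addr0. Qed.

Lemma bip_tensl X A P Q : is_bip A P Q -> is_bip (X ⊗ A) (X ⊗ P) (X ⊗ Q).
Proof.
move=> [i [p [j [q [pi qj qi pj ij]]]]].
exists (tensm (idm X) i), (tensm (idm X) p), (tensm (idm X) j), (tensm (idm X) q).
by split; rewrite -!tensmC ?comp1m -?tensmDr ?pi ?qj ?qi ?pj ?ij ?tensm1 ?tensm0.
Qed.

Lemma bip_tensr X A P Q : is_bip A P Q -> is_bip (A ⊗ X) (P ⊗ X) (Q ⊗ X).
Proof.
move=> [i [p [j [q [pi qj qi pj ij]]]]].
exists (tensm i (idm X)), (tensm p (idm X)), (tensm j (idm X)), (tensm q (idm X)).
by split; rewrite -!tensmC ?comp1m -?tensmDl ?pi ?qj ?qi ?pj ?ij ?tensm1 ?tens0m.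
Qed.

Lemma zero_tensl X A : is_zero_obj A -> is_zero_obj (X ⊗ A).
Proof. by rewrite /is_zero_obj => z; rewrite -tensm1 z tensm0. Qed.

Lemma zero_tensr X A : is_zero_obj A -> is_zero_obj (A ⊗ X).
Proof. by rewrite /is_zero_obj => z; rewrite -tensm1 z tens0m. Qed.

End Tensor.

Section Multiplicity.
Variables (C : finMonCat) (r : nat) (I : 'I_r.+1 -> C).
Hypothesis reps : is_indec_reps I.
Implicit Types A B P Q X : C.

Let addC := @fmc_additive C.
Let KS := @fmc_krull_schmidt C.

Lemma reps_local i : local_end (I i).
Proof.
by have [_ ind _ _] := reps; apply: (indecomposable_local_end addC KS (ind i)).
Qed.

Lemma is_decomp_decomp A : is_decomp I A (decomp I A).
Proof. by have [_ _ _ ex] := reps; apply: decompP KS ex. Qed.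

Lemma multE A s k : is_decomp I A s -> mult I k A = count_mem k s.
Proof.
have [_ _ inj _] := reps => bs; apply/permP.
exact: (krull_schmidt_uniq addC reps_local inj (is_decomp_decomp A) bs).
Qed.

Lemma mult_iso A B k : isomorphic A B -> mult I k A = mult I k B.
Proof.
move=> AB; apply/esym/multE.
exact: is_biproduct_isor AB (is_decomp_decomp A).
Qed.

Lemma mult_zero A k : is_zero_obj A -> mult I k A = 0%N.
Proof. by move=> /(is_decomp_nil I) /multE ->. Qed.

Lemma mult_bip A P Q k :
  is_bip A P Q -> mult I k A = (mult I k P + mult I k Q)%N.
Proof.
move=> bA; rewrite -count_cat; apply: multE.
exact: (is_decomp_cat addC bA (is_decomp_decomp P) (is_decomp_decomp Q)).
Qed.

Lemma mult_rep j k : mult I k (I j) = (j == k).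
Proof.
rewrite (@multE _ [:: j]); first by rewrite /= addn0.
apply/(is_decomp_cons addC).
have [Z bZ] := addC (fun i : 'I_0 => I j).
have zZ : is_zero_obj Z by apply/is_biproduct0/bZ.
exists Z; split; last exact/is_decomp_nil.
exists (idm _), (idm _), 0, 0.
by split; rewrite ?comp1m ?comp0m ?compm0 ?addr0.
Qed.

Lemma mult_additive (T : C -> C) A k :
  (forall A P Q, is_bip A P Q -> is_bip (T A) (T P) (T Q)) ->
  (forall A, is_zero_obj A -> is_zero_obj (T A)) ->
  mult I k (T A) = (\sum_j mult I j A * mult I k (T (I j)))%N.
Proof.
move=> Tbip Tzero; rewrite -sum_count_mem.
have := is_decomp_decomp A; move: (decomp I A) => s.
elim: s A => [|j s IH] A.
  by move=> zA; rewrite big_nil mult_zero //; apply/Tzero/(is_decomp_nil I)/zA.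
move=> /(is_decomp_cons addC) [B [bA Bs]].
by rewrite big_cons (mult_bip _ (Tbip _ _ _ bA)) (IH B).
Qed.

Lemma size_decomp A : size (decomp I A) = (\sum_k mult I k A)%N.
Proof.
rewrite -sum1_size sum_count_mem.
by apply: eq_bigr => k _; rewrite muln1.
Qed.

Variable X : C.

Lemma mult_tpow n j k :
  mult I k (tpow X n.+1 ⊗ I j) =
  (\sum_l pre_action_mx I X k l * mult I l (tpow X n ⊗ I j))%N.
Proof.
have -> : mult I k (tpow X n.+1 ⊗ I j) = mult I k (X ⊗ (tpow X n ⊗ I j)).
  by apply: mult_iso; exists (assoc X (tpow X n) (I j)); apply: assoc_iso.
rewrite (@mult_additive (fun A => X ⊗ A)) //.
- by apply: eq_bigr => l _; rewrite mxE mulnC.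
- by move=> A P Q; apply: bip_tensl.
- by move=> A; apply: zero_tensl.
Qed.

Lemma mult_tpow0 j k : mult I k (tpow X 0 ⊗ I j) = (j == k).
Proof.
rewrite -mult_rep; apply: mult_iso.
by exists (lunit (I j)); apply: lunit_iso.
Qed.

Lemma pre_action_mx_out k l :
  k \in unit_component I X -> l \notin unit_component I X ->
  pre_action_mx I X k l = 0%N /\ pre_action_mx I X l k = 0%N.
Proof.
rewrite !inE => ck /negP cl; split; apply/eqP/negPn/negP => kl; case: cl.
  by apply: connect_trans ck (connect1 _); rewrite kl.
by apply: connect_trans ck (connect1 _); rewrite kl orbT.
Qed.

Lemma mult_tpow_out n j k :
  j \in unit_component I X -> k \notin unit_component I X ->
  mult I k (tpow X n ⊗ I j) = 0%N.
Proof.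
move=> cj; elim: n k => [|n IH] k ck.
  by rewrite mult_tpow0; case: eqP ck => // <-; rewrite cj.
rewrite mult_tpow big1 // => l _.
have [cl|cl] := boolP (l \in unit_component I X); last by rewrite IH ?muln0.
by rewrite (pre_action_mx_out cl ck).2.
Qed.

Lemma sum_component (f : 'I_r.+1 -> nat) :
  (forall k, k \notin unit_component I X -> f k = 0%N) ->
  (\sum_k f k = \sum_(i < #|unit_component I X|) f (enum_val i))%N.
Proof.
move=> f0; rewrite -(big_enum_val f) /=.
by rewrite [RHS]big_mkcond; apply: eq_bigr => k _; case: ifPn => // /f0.
Qed.

Section Powers.
Variable R : realType.
Let M := cmx R (action_mx I X).

Lemma action_mx_pow n i j :
  (M ^+ n) i j = (mult I (enum_val i) (tpow X n ⊗ I (enum_val j)))%:R.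
Proof.
elim: n i => [|n IH] i.
  by rewrite mult_tpow0 expr0 mxE (inj_eq enum_val_inj) eq_sym.
rewrite exprS mult_tpow sum_component => [|k ck]; last first.
  by rewrite (pre_action_mx_out (enum_valP i) ck).1.
rewrite natr_sum mxE; apply: eq_bigr => l _.
by rewrite IH natrM !mxE.
Qed.

Lemma col_sum_action n j :
  col_sum (M ^+ n) j = (size (decomp I (tpow X n ⊗ I (enum_val j))))%:R.
Proof.
rewrite size_decomp sum_component => [|k ck]; last first.
  exact: mult_tpow_out (enum_valP j) ck.
by rewrite natr_sum; apply: eq_bigr => i _; rewrite action_mx_pow.
Qed.

Lemma col_sum_unit n :
  col_sum (M ^+ n) (unit_index I X) = (nb_summands I X n)%:R.
Proof.
rewrite col_sum_action /unit_index enum_rankK_in ?unit_in_component //.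
rewrite /nb_summands !size_decomp; congr _%:R.
have [-> _ _ _] := reps; apply: eq_bigr => k _; apply: mult_iso.
by exists (runit (tpow X n)); apply: runit_iso.
Qed.

End Powers.

Lemma size_tpow_tens : exists K : nat, forall n j,
  (size (decomp I (tpow X n ⊗ I j)) <= K * nb_summands I X n)%N.
Proof.
exists (\sum_j \sum_l \sum_k mult I k (I l ⊗ I j))%N => n j.
rewrite /nb_summands !size_decomp.
under eq_bigr => k _.
  rewrite (@mult_additive (fun A => A ⊗ I j)); first over.
  - by move=> A P Q; apply: bip_tensr.
  - by move=> A; apply: zero_tensr.
rewrite exchange_big /= big_distrr; apply: leq_sum => l _ /=.
rewrite -[leqLHS]big_distrr /= [leqLHS]mulnC leq_mul2r; apply/orP; right.
rewrite [leqRHS](bigD1 j) //= [X in (_ <= X + _)%N](bigD1 l) //=.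
by rewrite -addnA leq_addr.
Qed.

End Multiplicity.

(** * Peripheral eigenvalues and deflation *)

Section Perron.
Variable R : realType.
Local Notation normc := (@Normc.normc R).

Lemma norm_normc (x : R[i]) : `|x| = (normc x)%:C.
Proof. by case: x => a b; rewrite normc_def. Qed.

Lemma normc_real (x : R) : 0 <= x -> normc x%:C = x.
Proof. by move=> x0; rewrite /= expr0n addr0 sqrtr_sqr ger0_norm. Qed.

Lemma normcX (x : R[i]) n : normc (x ^+ n) = normc x ^+ n.
Proof.
by elim: n => [|n IH]; rewrite ?Normc.normc1 // !exprS Normc.normcM IH.
Qed.

Lemma eigenvalue_root m (M : 'M[R[i]]_m) mu :
  eigenvalue M mu = root (char_poly M) mu.
Proof.
case: m => [|m] in M *; last exact: eigenvalue_root_char.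
rewrite /char_poly det_mx00 (negPf (root1 _)); apply/negbTE.
by rewrite negbK; apply/eqP/matrixP => -[].
Qed.

Lemma col_sumE m (A : 'M[R[i]]_m) j :
  col_sum A j = ((const_mx 1 : 'rV[R[i]]_m) *m A *m delta_mx j (0 : 'I_1)) 0 0.
Proof.
by rewrite -colE !mxE; apply: eq_bigr => i _; rewrite mxE mul1r.
Qed.

Variables (m : nat) (M : 'M[R[i]]_m) (pf : R) (h : nat).
Hypothesis PF : perron_frobenius M pf h.
Local Notation ev k := (rootu R h ^+ k * pf%:C).

Lemma peripheral_nontrivial (k : nat) :
  (0 < k < h)%N -> normc (ev k) = pf /\ ev k <> pf%:C.
Proof.
have [_ _ _ _ per] := PF => kh.
by have /per[] : exists2 j : nat, (0 < j < h)%N & ev k = ev j by exists k.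
Qed.

Lemma peripheral_norm (k : 'I_h) : normc (ev k) = pf.
Proof.
have [pf0 _ _ _ _] := PF.
have [k0|k0] := posnP k; first by rewrite k0 mul1r normc_real // ltW.
by apply: (peripheral_nontrivial _).1; rewrite k0 ltn_ord.
Qed.

Lemma peripheral_inj : injective (fun k : 'I_h => ev k).
Proof.
have [pf0 _ _ _ _] := PF.
have pfn0 : pf%:C != 0 by rewrite (inj_eq (@complexI R)) gt_eqF.
have main (k l : 'I_h) : (k < l)%N -> ev k <> ev l.
  move=> kl e; have lk : (0 < l - k < h)%N.
    by rewrite subn_gt0 kl (leq_ltn_trans (leq_subr _ _)).
  have [_] := peripheral_nontrivial lk; apply.
  move: e => /(mulIf pfn0); rewrite -(subnK (ltnW kl)) addnK exprD.
  have : ev k != 0.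
    rewrite -normr_eq0 norm_normc peripheral_norm.
    by rewrite (inj_eq (@complexI R)) gt_eqF.
  rewrite mulf_eq0 negb_or => /andP[zk0 _].
  by rewrite -{1}[rootu R h ^+ k]mul1r => /(mulIf zk0) <-; rewrite mul1r.
move=> k l /= e; apply/val_inj => /=.
by case: (ltngtP k l) => // /main; rewrite e.
Qed.

Lemma peripheral_eigenvalue mu :
  eigenvalue M mu -> normc mu = pf -> exists k : 'I_h, mu = ev k.
Proof.
have [pf0 _ _ h0 per] := PF => evmu nmu.
have [->|/eqP npf] := eqVneq mu pf%:C; first by exists (Ordinal h0); rewrite mul1r.
have [k /andP[_ kh] ->] := (per mu).1 (conj evmu (conj nmu npf)).
by exists (Ordinal kh).
Qed.

Variables v w : 'I_h -> 'cV[R[i]]_m.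
Hypothesis right_eig : forall k : 'I_h, M *m v k = ev k *: v k.
Hypothesis left_eig : forall k : 'I_h, (w k)^T *m M = ev k *: (w k)^T.
Hypothesis normalized : forall k : 'I_h, (w k)^T *m v k = 1%:M.

Let V : 'M[R[i]]_(m, h) := \matrix_(i, k) v k i 0.
Let W : 'M[R[i]]_(h, m) := \matrix_(k, i) w k i 0.
Let D : 'rV[R[i]]_h := \row_k ev k.
Let N := M - V *m diag_mx D *m W.

Lemma eigvec_orthogonal (k l : 'I_h) : k != l -> (w k)^T *m v l = 0.
Proof.
move=> kl; have : (ev k - ev l) *: ((w k)^T *m v l) = 0.
  rewrite scalerBl scalemxAl -left_eig scalemxAr -right_eig.
  by rewrite mulmxA subrr.
move/eqP; rewrite scaler_eq0 => /orP[|/eqP //].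
by rewrite subr_eq0 (inj_eq peripheral_inj) (negPf kl).
Qed.

Let WV : W *m V = 1%:M.
Proof.
apply/matrixP => k l; rewrite [RHS]mxE.
transitivity (((w k)^T *m v l) 0 0).
  by rewrite !mxE; apply: eq_bigr => i _; rewrite !mxE.
have [<-|kl] := eqVneq; first by rewrite normalized mxE eqxx.
by rewrite eigvec_orthogonal // mxE.
Qed.

Let MV : M *m V = V *m diag_mx D.
Proof.
apply/matrixP => i k; rewrite mul_mx_diag !mxE.
transitivity ((M *m v k) i 0); last by rewrite right_eig mxE mulrC.
by rewrite mxE; apply: eq_bigr => j _; rewrite !mxE.
Qed.

Let WM : W *m M = diag_mx D *m W.
Proof.
apply/matrixP => k i; rewrite mul_diag_mx !mxE.
transitivity (((w k)^T *m M) 0 i); last by rewrite left_eig !mxE.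
by rewrite mxE; apply: eq_bigr => j _; rewrite !mxE.
Qed.

Lemma powers_deflate n :
  M ^+ n = \sum_(k < h) ev k ^+ n *: (v k *m (w k)^T) +
    N ^+ n *m (1%:M - V *m W).
Proof.
transitivity (V *m diag_mx (\row_(k < h) ev k ^+ n) *m W +
    N ^+ n *m (1%:M - V *m W)).
  elim: n => [|n IH].
    have -> : diag_mx (\row_(k < h) ev k ^+ 0) = 1%:M :> 'M[R[i]]_h.
      by apply/matrixP => i j; rewrite !mxE.
    by rewrite mulmx1 !expr0 mul1mx addrC subrK.
  have WN : W *m N = 0.
    by rewrite mulmxBr !mulmxA WV mul1mx WM subrr.
  have -> : diag_mx (\row_(k < h) ev k ^+ n.+1) =
      diag_mx D *m diag_mx (\row_(k < h) ev k ^+ n).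
    rewrite mulmx_diag; congr diag_mx; apply/rowP => k.
    by rewrite !mxE exprS.
  rewrite exprS -[M * _]/(M *m _) {}IH mulmxDr !mulmxA MV; congr (_ + _).
  have {1}-> : M = N + V *m diag_mx D *m W by rewrite subrK.
  rewrite mulmxDl mulmxDl exprS -[N * _]/(N *m _) -[RHS]addr0; congr (_ + _).
  case: n => [|n].
    rewrite expr0 mulmx1 -mulmxA mulmxBr mulmx1 mulmxA WV mul1mx subrr.
    by rewrite mulmx0.
  rewrite exprS -[N * _]/(N *m _) !mulmxA -[_ *m W *m N]mulmxA.
  by rewrite WN mulmx0 !mul0mx.
congr (_ + _); apply/matrixP => i j; rewrite summxE mxE.
by apply: eq_bigr => k _; rewrite mul_mx_diag !mxE big_ord1 !mxE; ring.
Qed.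

Hypothesis tr0 : forall n, 0 <= \tr (M ^+ n).

Lemma deflated_root mu : root (char_poly N) mu ->
  mu = 0 \/ eigenvalue M mu /\ normc mu < pf.
Proof.
have [pf0 [_ evpf] mup1 _ _] := PF.
move=> rmu; have [->|mu0] := eqVneq mu 0; [by left | right].
have E := char_poly_deflate MV WV; rewrite -/N in E.
have evmu : eigenvalue M mu.
  have : root (char_poly N * \prod_(k < h) ('X - (D 0 k)%:P)) mu.
    by rewrite rootM rmu.
  rewrite E rootM /root hornerXn expf_eq0 (negPf mu0) andbF /=.
  by rewrite eigenvalue_root.
split=> //; rewrite lt_neqAle evpf // andbT; apply/eqP => nmu.
have [k muk] := peripheral_eigenvalue evmu nmu.
have : (mup mu (char_poly M) <= 1)%N.
  rewrite -mup1; apply: mup_char_poly_le tr0 _ _.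
  - by rewrite (ltcR 0).
  - by move=> nu; rewrite -eigenvalue_root => /evpf; rewrite norm_normc lecR.
  - by rewrite norm_normc nmu.
have Mn0 n (A : 'M[R[i]]_n) : char_poly A != 0.
  by rewrite monic_neq0 // char_poly_monic.
have P0 : \prod_(k < h) ('X - (D 0 k)%:P) != 0 :> {poly R[i]}.
  by rewrite monic_neq0 // monic_prod_XsubC.
have := congr1 (mup mu) E.
rewrite mupM // mupM ?expf_neq0 ?polyX_eq0 //.
rewrite (@mupNroot _ _ ('X ^+ h)); last first.
  by rewrite /root hornerXn expf_eq0 (negPf mu0) andbF.
move=> {}E; rewrite add0n in E; rewrite -E leqNgt => /negP; apply.
rewrite -(addn1 1) leq_add // -XsubC_dvd // dvdp_XsubCl //.
by rewrite (bigD1 k) //= rootM root_XsubC mxE muk eqxx.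
Qed.

Lemma deflated_bound (e : 'I_m) (g : R) : 0 < g ->
  (forall mu, eigenvalue M mu -> normc mu < pf -> normc mu < g) ->
  exists K : R, forall n,
    normc (col_sum (M ^+ n) e -
      (\sum_(k < h) col_sum (v k *m (w k)^T) e * (rootu R h ^+ k) ^+ n)
        * pf%:C ^+ n)
      <= K * g ^+ n.
Proof.
move=> g0 small.
have small' mu : root (char_poly N) mu -> `|mu| < g%:C.
  rewrite norm_normc ltcR => /deflated_root [->|[]]; last exact: small.
  by rewrite Normc.normc0.
have [K HK] := mx_pow_bound (const_mx 1)
  ((1%:M - V *m W) *m delta_mx e 0) small'.
have K0 : 0 <= K by have := le_trans (normr_ge0 _) (HK 0%N); rewrite mulr1.
exists (complex.Re K) => n; rewrite -lecR -norm_normc.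
rewrite rmorphM rmorphXn /= RRe_real ?ger0_real //; apply: le_trans (HK n).
rewrite le_eqVlt; apply/orP; left; apply/eqP; congr `|_|.
rewrite powers_deflate col_sumE mulmxDr mulmxDl mxE addrAC.
rewrite mulmx_sumr mulmx_suml summxE mulr_suml -sumrB big1 ?add0r => [|k _].
  by rewrite !mulmxA.
by rewrite -scalemxAr -scalemxAl mxE -col_sumE exprMn; ring.
Qed.

Hypothesis M0 : forall n i j, 0 <= (M ^+ n) i j.

Lemma perron_growth (b : nat -> nat) (K : nat) :
  (forall n j, col_sum (M ^+ n) j <= (K * b n)%:R) ->
  exists K' : R, forall n, pf ^+ n <= K' * (b n)%:R.
Proof.
move=> HK; have [pf0 _ _ h0 _] := PF; pose k0 := Ordinal h0.
have [j wj] : exists j, w k0 j 0 != 0.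
  apply/existsP; apply: contraT; rewrite negb_exists => /forallP w0.
  have : (w k0)^T = 0.
    by apply/rowP => i; rewrite !mxE; apply/eqP; rewrite -[_ == _]negbK w0.
  move=> wz; have := normalized k0; rewrite wz mul0mx => /matrixP /(_ 0 0).
  by rewrite !mxE eqxx => /esym/eqP; rewrite oner_eq0.
have wM n : (w k0)^T *m M ^+ n = pf%:C ^+ n *: (w k0)^T.
  elim: n => [|n IH]; first by rewrite !expr0 mulmx1 scale1r.
  rewrite exprSr -[_ * M]/(_ *m M) mulmxA IH -scalemxAl left_eig scalerA.
  by rewrite expr0 mul1r exprSr.
pose S := \sum_i normc (w k0 i 0).
have wj0 : 0 < normc (w k0 j 0) by rewrite -ltcR -norm_normc normr_gt0.
exists (S / normc (w k0 j 0) * K%:R) => n.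
have -> : S / normc (w k0 j 0) * K%:R * (b n)%:R =
    (K * b n)%:R * S / normc (w k0 j 0) by rewrite natrM; ring.
rewrite ler_pdivlMr //.
rewrite -lecR 2!rmorphM rmorphXn rmorph_nat /= -norm_normc.
have -> : pf%:C ^+ n * `|w k0 j 0| = `|\sum_i w k0 i 0 * (M ^+ n) i j|.
  transitivity (`|(pf%:C ^+ n *: (w k0)^T) 0 j|).
    rewrite !mxE normrM ger0_norm // exprn_ge0 //.
    by rewrite (lecR 0) ltW.
  by rewrite -wM mxE; congr `|_|; apply: eq_bigr => i _; rewrite mxE.
apply: le_trans (ler_norm_sum _ _ _) _.
have S0 i : 0 <= normc (w k0 i 0).
  by rewrite -lecR -norm_normc; apply: normr_ge0.
apply: le_trans (ler_wpM2r _ (HK n j)); last first.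
  by rewrite (lecR 0) sumr_ge0.
rewrite /col_sum mulr_suml; apply: ler_sum => i _.
rewrite normrM mulrC ger0_norm // ler_wpM2l // norm_normc lecR.
by rewrite /S (bigD1 i) //= lerDl sumr_ge0.
Qed.

End Perron.

(** * Asymptotics *)

Section Asymptotics.
Variable R : realType.
Local Notation normc := (@Normc.normc R).

Lemma normc_ge0 (x : R[i]) : 0 <= normc x.
Proof. by case: x => a b; apply: sqrtr_ge0. Qed.

Lemma le_normcD (x y : R[i]) : normc (x + y) <= normc x + normc y.
Proof. by rewrite -lecR rmorphD /= -!norm_normc ler_normD. Qed.

Lemma bounded_fun_eventually (f : nat -> R[i]^o) (N : nat) (B : R) :
  (forall n, (N <= n)%N -> normc (f n) <= B) -> bounded_fun f.
Proof.
move=> fB; pose S := \sum_(n < N) normc (f n).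
have S0 : 0 <= S by apply: sumr_ge0 => i _; apply: normc_ge0.
exists (S + `|B|)%:C; split=> [|x xB n _].
  by rewrite realE (lecR 0) addr_ge0.
apply: le_trans (ltW xB); rewrite [leLHS]norm_normc lecR.
have [Nn|nN] := leqP N n.
  by rewrite (le_trans (fB n Nn)) // (le_trans (ler_norm B)) // lerDr.
rewrite /S (bigD1 (Ordinal nN)) //= -addrA lerDl addr_ge0 // sumr_ge0 // => i _.
exact: normc_ge0.
Qed.

Lemma spectral_gap m (M : 'M[R[i]]_m) (pf : R) : 0 < pf ->
  exists2 g : R, 0 < g < 1 &
    forall mu, eigenvalue M mu -> normc mu < pf -> normc mu < g * pf.
Proof.
move=> pf0; have [s Ms _] := mxtrace_exp M.
suff [g g01 gs] : exists2 g : R, 0 < g < 1 &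
    forall mu, mu \in s -> normc mu < pf -> normc mu < g * pf.
  exists g => // mu; rewrite eigenvalue_root Ms root_prod_XsubC; exact: gs.
elim: s {Ms} => [|nu s [g /andP[g0 g1] gs]].
  by exists 2^-1 => //; apply/andP; split; lra.
have [nupf|nupf] := ltP (normc nu) pf; last first.
  exists g; rewrite ?g0 // => mu; rewrite inE => /orP[/eqP->|/gs //].
  by rewrite ltNge nupf.
pose q := normc nu / pf.
have q1 : q < 1 by rewrite /q ltr_pdivrMr // mul1r.
have q0 : 0 <= q by rewrite /q divr_ge0 ?normc_ge0 // ltW.
have nuq : normc nu = q * pf by rewrite /q divfK ?gt_eqF.
exists (Num.max g ((q + 1) / 2)).
  by rewrite lt_max gt_max g0 g1 /=; lra.
move=> mu; rewrite inE => /orP[/eqP-> _|/gs H /H {}H].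
  by rewrite nuq ltr_pM2r // lt_max; apply/orP; right; lra.
by apply: lt_le_trans H _; rewrite ler_pM2r // le_max lexx.
Qed.

Lemma powR_invn_cvg1 (c : R) : 0 < c -> c `^ (n%:R^-1) @[n --> \oo] --> (1 : R).
Proof.
move=> c0.
have inv0 : (n%:R^-1 : R) @[n --> \oo] --> (0 : R).
  rewrite -cvg_shiftS; exact: cvg_harmonic.
have -> : (fun n => c `^ (n%:R^-1)) = (fun n => expR (n%:R^-1 * ln c)).
  by apply/funext => n; rewrite /powR gt_eqF.
suff : expR (n%:R^-1 * ln c) @[n --> \oo] --> expR (0 * ln c).
  by rewrite mul0r expR0.
apply: continuous_cvg; first exact: continuous_expR.
exact: cvgMr_tmp.
Qed.

Lemma nth_root_cvg (b : nat -> R) (c A pf : R) : 0 < c -> 0 < pf ->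
  (forall n, c * pf ^+ n <= b n <= A * pf ^+ n) ->
  (fun n => b n `^ (n%:R^-1)) @ \oo --> pf.
Proof.
move=> c0 pf0 cbA.
have A0 : 0 < A.
  by have /andP[/le_trans H /H] := cbA 0%N; rewrite !mulr1; apply: lt_le_trans.
have rt (x : R) n : 0 < x -> (0 < n)%N ->
    (x * pf ^+ n) `^ (n%:R^-1) = x `^ (n%:R^-1) * pf.
  move=> x0 n0; rewrite powRM ?exprn_ge0 // ?ltW //.
  rewrite -powR_mulrn ?(ltW pf0) // -powRrM divff ?pnatr_eq0 -?lt0n //.
  by rewrite powRr1 // ltW.
have lim (x : R) : 0 < x -> x `^ (n%:R^-1) * pf @[n --> \oo] --> pf.
  move=> x0; suff : x `^ (n%:R^-1) * pf @[n --> \oo] --> 1 * pf.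
    by rewrite mul1r.
  by apply: cvgMr_tmp; exact: powR_invn_cvg1.
apply: (squeeze_cvgr _ (lim _ c0) (lim _ A0)).
exists 1%N => // n /= n0; have /andP[cb bA] := cbA n.
have low : 0 <= c * pf ^+ n by rewrite mulr_ge0 ?exprn_ge0 // ltW.
have i0 : 0 <= n%:R^-1 :> R by rewrite invr_ge0.
rewrite -!rt //; apply/andP; split; apply: ge0_ler_powR => //.
- exact: le_trans cb.
- exact: le_trans cb.
- by rewrite nnegrE (le_trans (le_trans low cb)).
Qed.

Section Ratio.
Variables (b : nat -> nat) (a : nat -> R[i]) (pf K : R).
Hypothesis pf0 : 0 < pf.
Hypothesis growth : forall n, pf ^+ n <= K * (b n)%:R.

Lemma growth_const_gt0 : 0 < K.
Proof.
have := growth 0; rewrite expr0 => H; rewrite ltNge; apply/negP => K0.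
have : K * (b 0)%:R <= 0 by rewrite mulr_le0_ge0.
by move=> /(le_trans H); rewrite ler10.
Qed.

Lemma growth_lower n : K^-1 * pf ^+ n <= (b n)%:R.
Proof. by rewrite mulrC ler_pdivrMr ?growth_const_gt0 // mulrC. Qed.

Variables (g B : R).
Hypothesis g01 : 0 < g < 1.
Hypothesis close : forall n, normc ((b n)%:R - a n) <= B * (g * pf) ^+ n.

Lemma leading_term_lower :
  exists N, forall n, (N <= n)%N -> (K^-1 / 2) * pf ^+ n <= normc (a n).
Proof.
have /andP[g0 g1] := g01; have K0 := growth_const_gt0.
have Bg : B * g ^+ n @[n --> \oo] --> (0 : R).
  suff : B * g ^+ n @[n --> \oo] --> B * 0 by rewrite mulr0.
  by apply: cvgMl_tmp; apply: cvg_expr; rewrite gtr0_norm.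
have K20 : 0 < K^-1 / 2 by rewrite divr_gt0 // invr_gt0.
have [N _ HN] := (cvgrPdist_le _ _).1 Bg _ K20.
exists N => n /HN /=; rewrite sub0r normrN => /(le_trans (ler_norm _)) Hn.
have pfn : 0 <= pf ^+ n by rewrite exprn_ge0 // ltW.
have := close n; rewrite exprMn mulrA => /le_trans /(_ (ler_wpM2r pfn Hn)) Hd.
have := le_normcD ((b n)%:R - a n) (a n); rewrite subrK.
have -> : normc (b n)%:R = (b n)%:R.
  by rewrite -(rmorph_nat (real_complex R)) normc_real.
move/(le_trans (growth_lower n)) => H.
have E : K^-1 * pf ^+ n = K^-1 / 2 * pf ^+ n + K^-1 / 2 * pf ^+ n.
  by rewrite -mulrDl -splitr.
by lra.
Qed.

End Ratio.

Lemma ratio_bound (b : nat -> nat) (a : nat -> R[i]) (pf c g B : R) n :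
  0 < pf -> 0 < c -> c * pf ^+ n <= normc (a n) ->
  normc ((b n)%:R - a n) <= B * (g * pf) ^+ n ->
  normc ((b n)%:R / a n - 1) <= B / c * g ^+ n.
Proof.
move=> pf0 c0 ca cl.
have cp0 : 0 < c * pf ^+ n by rewrite mulr_gt0 ?exprn_gt0.
have na0 := lt_le_trans cp0 ca.
have a0 : a n != 0 by apply: contraTneq na0 => ->; rewrite Normc.normc0 ltxx.
have -> : (b n)%:R / a n - 1 = ((b n)%:R - a n) / a n by rewrite mulrBl divff.
rewrite Normc.normcM Normc.normcV ler_pdivrMr //; apply: (le_trans cl).
have Bg : 0 <= B / c * g ^+ n.
  have : 0 <= B * g ^+ n * pf ^+ n.
    by rewrite -mulrA -exprMn; apply: le_trans cl; apply: normc_ge0.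
  by rewrite pmulr_lge0 ?exprn_gt0 // mulrAC => H; rewrite divr_ge0 // ltW.
rewrite exprMn; apply: le_trans (ler_wpM2l Bg ca).
by rewrite le_eqVlt; apply/orP; left; apply/eqP; field; apply: lt0r_neq0.
Qed.

End Asymptotics.

Theorem theorem2 (R : realType) (C : finMonCat) (r : nat) (I : 'I_r.+1 -> C)
    (reps : is_indec_reps I) (X : C)
    (pf : R) (h : nat)
    (PF : perron_frobenius (cmx R (action_mx I X)) pf h)
    (v w : 'I_h -> 'cV[R[i]]_#|unit_component I X|)
    (right_eig : forall k : 'I_h,
       cmx R (action_mx I X) *m v k = (rootu R h ^+ k * pf%:C) *: v k)
    (left_eig : forall k : 'I_h,
       (w k)^T *m cmx R (action_mx I X) = (rootu R h ^+ k * pf%:C) *: (w k)^T)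
    (normalized : forall k : 'I_h, (w k)^T *m v k = 1%:M) :
  let b (n : nat) : R[i] := (nb_summands I X n)%:R in
  let a (n : nat) : R[i] :=
    (\sum_(k < h) col_sum (v k *m (w k)^T) (unit_index I X)
                  * (rootu R h ^+ k) ^+ n) * pf%:C ^+ n in
  [/\ asym_equiv b a,
      forall lsec : R[i],
        second_eigenvalue (cmx R (action_mx I X)) pf lsec ->
        geometric_cvg (fun n => b n / a n) 1 (Normc.normc (lsec / pf%:C)) &
      (fun n : nat => ((nb_summands I X n)%:R : R) `^ (n%:R^-1)) @ \oo --> pf].
Proof.
move=> b a; set M := cmx R (action_mx I X) in PF right_eig left_eig *.
have [pf0 _ _ _ _] := PF.
have M0 n i j : 0 <= (M ^+ n) i j by rewrite action_mx_pow.
have tr0 n : 0 <= \tr (M ^+ n) by apply: sumr_ge0 => i _; apply: M0.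
have [K0 HK0] := size_tpow_tens reps X.
have [K growth] : exists K : R, forall n, pf ^+ n <= K * (nb_summands I X n)%:R.
  apply: (perron_growth PF left_eig normalized M0 (K := K0)) => n j.
  by rewrite col_sum_action // ler_nat.
have close g : 0 < g ->
    (forall mu, eigenvalue M mu -> Normc.normc mu < pf ->
      Normc.normc mu < g * pf) ->
    exists B : R, forall n, Normc.normc (b n - a n) <= B * (g * pf) ^+ n.
  move=> g0 small.
  have [||B HB] := deflated_bound PF right_eig left_eig normalized tr0
    (unit_index I X) (g := g * pf); [by rewrite mulr_gt0 | exact: small |].
  by exists B => n; have := HB n; rewrite col_sum_unit.
have [g g01 small] := spectral_gap M pf0; have /andP[g0 g1] := g01.
have [B HB] := close g g0 small.
have [N HN] := leading_term_lower pf0 growth g01 HB.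
have c0 : 0 < K^-1 / 2 by rewrite divr_gt0 // invr_gt0 (growth_const_gt0 growth).
split.
- apply: (proj2 (@cvgrPdist_le R[i] (R[i]^o) nat \oo _
    (fun n => b n / a n) 1)) => e e0.
  have eE : e = (complex.Re e)%:C by rewrite RRe_real // ger0_real // ltW.
  have e0' : 0 < complex.Re e by rewrite -ltcR -eE.
  have Bg : B / (K^-1 / 2) * g ^+ n @[n --> \oo] --> (0 : R).
    suff : B / (K^-1 / 2) * g ^+ n @[n --> \oo] --> B / (K^-1 / 2) * 0.
      by rewrite mulr0.
    by apply: cvgMl_tmp; apply: cvg_expr; rewrite gtr0_norm.
  have [N' _ HN'] := (cvgrPdist_le _ _).1 Bg _ e0'.
  exists (maxn N N') => // n /=; rewrite geq_max => /andP[Nn /HN' /=].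
  rewrite sub0r normrN => /(le_trans (ler_norm _)) Hn.
  rewrite distrC eE norm_normc lecR; apply: le_trans Hn.
  exact: ratio_bound (HN n Nn) (HB n).
- move=> lsec lsecP gamma lg g1'.
  have gamma0 : 0 < gamma by apply: le_lt_trans lg; apply: normc_ge0.
  have [|B' HB'] := close gamma gamma0.
    move=> mu evmu mupf.
    case: lsecP => [[_ _ /(_ mu evmu mupf) le]|[/(_ mu evmu) //]].
    apply: le_lt_trans le _; move: lg; rewrite Normc.normcM Normc.normcV.
    by rewrite normc_real ?(ltW pf0) // ltr_pdivrMr.
  apply: (@bounded_fun_eventually _ _ N (B' / (K^-1 / 2))) => n Nn.
  rewrite Normc.normcM Normc.normcV normcX normc_real ?(ltW gamma0) //.
  rewrite ler_pdivrMr ?exprn_gt0 //.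
  exact: ratio_bound (HN n Nn) (HB' n).
- pose A := \sum_(k < h)
    Normc.normc (col_sum (v k *m (w k)^T) (unit_index I X)) + `|B|.
  apply: (nth_root_cvg (c := K^-1) (A := A)) => // [|n].
    by rewrite invr_gt0 (growth_const_gt0 growth).
  rewrite (growth_lower growth) /=.
  have bE : (nb_summands I X n)%:R = Normc.normc (b n).
    by rewrite /b -(rmorph_nat (real_complex R)) normc_real.
  have pfn : 0 < pf ^+ n by rewrite exprn_gt0.
  rewrite bE -[b n](subrK (a n)) (le_trans (le_normcD _ _)) // addrC.
  rewrite /A mulrDl lerD //; last first.
    apply: le_trans (HB n) _; rewrite exprMn mulrA ler_wpM2r ?(ltW pfn) //.
    rewrite (le_trans (ler_norm _)) // normrM ler_piMr //.
    rewrite ger0_norm ?exprn_ge0 ?(ltW g0) //.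
    by rewrite exprn_ile1 ?ltW.
  rewrite /a mulr_suml mulr_suml.
  apply: (@le_trans _ _ (\sum_(k < h) Normc.normc (col_sum (v k *m (w k)^T)
    (unit_index I X) * (rootu R h ^+ k * pf%:C) ^+ n))).
    rewrite -lecR -norm_normc rmorph_sum /=.
    apply: le_trans (ler_norm_sum _ _ _) _; apply: ler_sum => k _.
    by rewrite norm_normc exprMn mulrA.
  apply: ler_sum => k _.
  by rewrite Normc.normcM normcX (peripheral_norm PF).
Qed.
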